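(* Let $\mathcal{A}$ be an abelian monoidal category with biexact tensor product and let $\mathcal{C}$ be a two-sided Serre tensor-ideal of $\mathcal{A}$. Equip $\mathcal{A}/\mathcal{C}$ with the monoidal structure induced from $\mathcal{A}$ (as defined in the context). Then the canonical functor $T:\mathcal{A}\to\mathcal{A}/\mathcal{C}$ is a monoidal functor.
   Context: A Serre subcategory of an abelian category $\mathcal{A}$ is a full additive subcategory closed under subobjects, quotients and extensions. The quotient category $\mathcal{A}/\mathcal{C}$ has the same objects as $\mathcal{A}$, and $\mathrm{Hom}_{\mathcal{A}/\mathcal{C}}(M,N)=\varinjlim_{M',N'}\mathrm{Hom}_{\mathcal{A}}(M',N/N')$, where $M'\subset M$ and $N'\subset N$ run over the subobjects with $M/M'\in\mathcal{C}$ and $N'\in\mathcal{C}$; $T:\mathcal{A}\to\mathcal{A}/\mathcal{C}$ is the canonical functor. For $f:M'\to N/N'$ in this direct system, the morphism $M\to N$ of $\mathcal{A}/\mathcal{C}$ represented by $f$ is also written $Tf$; every morphism of $\mathcal{A}/\mathcal{C}$ is of this form. A two-sided Serre tensor-ideal of an abelian monoidal category $\mathcal{A}$ is a Serre subcategory $\mathcal{C}$ such that $X\otimes Y\in\mathcal{C}$ and $Y\otimes X\in\mathcal{C}$ for all $X\in\mathcal{A}$, $Y\in\mathcal{C}$. Monoidal structure on $\mathcal{A}/\mathcal{C}$: the tensor product of objects is that of $\mathcal{A}$, and the unit object is that of $\mathcal{A}$. If $\bar f=Tf:M\to N$ and $\bar g=Tg:X\to Y$ are morphisms of $\mathcal{A}/\mathcal{C}$,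 represented by $f:M'\to N/N'$ and $g:X'\to Y/Y'$, then $\bar f\otimes\bar g:=T(f\otimes g):M\otimes X\to N\otimes Y$ is the morphism of $\mathcal{A}/\mathcal{C}$ represented by $f\otimes g:M'\otimes X'\to (N/N')\otimes(Y/Y')$, where $M'\otimes X'$ is regarded as a subobject of $M\otimes X$ and $(N/N')\otimes(Y/Y')$ as a quotient of $N\otimes Y$; this is well defined. The associativity constraint is $\bar a_{X,Y,Z}=T(a_{X,Y,Z})$ and the left and right unit isomorphisms are $T(l_X)$, $T(r_X)$, where $a,l,r$ are those of $\mathcal{A}$. *)

(* Defs.v *)
From HB Require Import structures.
From mathcomp Require Import ssreflect ssrfun ssrbool eqtype choice generic_quotient.
From mathcomp Require Import boolp.

Set Implicit Arguments.
Unset Strict Implicit.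
Unset Printing Implicit Defensive.

Local Open Scope quotient_scope.

Declare Scope cat_scope.
Delimit Scope cat_scope with cat.
Local Open Scope cat_scope.

Reserved Notation "g ∘ f" (at level 40, left associativity).

Record category := Category {
  obj :> Type;
  hom : obj -> obj -> Type;
  idm : forall X, hom X X;
  comp : forall X Y Z, hom Y Z -> hom X Y -> hom X Z;
  compA : forall X Y Z W (h : hom Z W) (g : hom Y Z) (f : hom X Y),
    comp h (comp g f) = comp (comp h g) f;
  comp1m : forall X Y (f : hom X Y), comp (idm Y) f = f;
  compm1 : forall X Y (f : hom X Y), comp f (idm X) = f }.

Arguments idm {_} X.
Arguments comp {_ X Y Z} g f.
Notation "g ∘ f" := (comp g f) : cat_scope.

Record functor (A B : category) := Functor {
  fobj :> A -> B;
  fmap : forall X Y : A, hom X Y -> hom (fobj X) (fobj Y);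
  fmap1 : forall X, fmap (idm X) = idm (fobj X);
  fmapM : forall X Y Z (g : hom Y Z) (f : hom X Y),
    fmap (g ∘ f) = fmap g ∘ fmap f }.

Arguments fmap {A B} F {X Y} f : rename.

Definition is_mono (A : category) (X Y : A) (f : hom X Y) : Prop :=
  forall W (u v : hom W X), f ∘ u = f ∘ v -> u = v.

Definition is_epi (A : category) (X Y : A) (f : hom X Y) : Prop :=
  forall W (u v : hom Y W), u ∘ f = v ∘ f -> u = v.

Definition is_iso (A : category) (X Y : A) (f : hom X Y) : Prop :=
  exists g : hom Y X, g ∘ f = idm X /\ f ∘ g = idm Y.

Definition is_zero_object (A : category) (Z : A) : Prop :=
  (forall X, exists! f : hom Z X, True) /\
  (forall X, exists! f : hom X Z, True).

Record preadditive := Preadditive {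
  pre_cat :> category;
  zerom : forall X Y : pre_cat, hom X Y;
  addm : forall X Y : pre_cat, hom X Y -> hom X Y -> hom X Y;
  oppm : forall X Y : pre_cat, hom X Y -> hom X Y;
  addmA : forall X Y (f g h : hom X Y), addm f (addm g h) = addm (addm f g) h;
  addmC : forall X Y (f g : hom X Y), addm f g = addm g f;
  add0m : forall X Y (f : hom X Y), addm (zerom X Y) f = f;
  addNm : forall X Y (f : hom X Y), addm (oppm f) f = zerom X Y;
  compDl : forall X Y Z (g g' : hom Y Z) (f : hom X Y),
    addm g g' ∘ f = addm (g ∘ f) (g' ∘ f);
  compDr : forall X Y Z (g : hom Y Z) (f f' : hom X Y),
    g ∘ addm f f' = addm (g ∘ f) (g ∘ f') }.

Arguments zerom {_ X Y}.
Arguments addm {_ X Y} f g.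
Arguments oppm {_ X Y} f.

Definition is_kernel (A : preadditive) (K X Y : A) (f : hom X Y) (k : hom K X)
    : Prop :=
  f ∘ k = zerom /\
  forall W (x : hom W X), f ∘ x = zerom -> exists! u : hom W K, k ∘ u = x.

Definition is_cokernel (A : preadditive) (X Y Q : A) (f : hom X Y)
    (c : hom Y Q) : Prop :=
  c ∘ f = zerom /\
  forall W (x : hom Y W), x ∘ f = zerom -> exists! u : hom Q W, u ∘ c = x.

Definition is_biproduct (A : preadditive) (X Y P : A) (i1 : hom X P)
    (i2 : hom Y P) (p1 : hom P X) (p2 : hom P Y) : Prop :=
  [/\ p1 ∘ i1 = idm X, p2 ∘ i2 = idm Y, p1 ∘ i2 = zerom, p2 ∘ i1 = zerom
    & addm (i1 ∘ p1) (i2 ∘ p2) = idm P].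

Record abelian := Abelian {
  ab_pre :> preadditive;
  ab_zero : exists Z : ab_pre, is_zero_object Z;
  ab_biproduct : forall X Y : ab_pre,
    exists P (i1 : hom X P) (i2 : hom Y P) (p1 : hom P X) (p2 : hom P Y),
      is_biproduct i1 i2 p1 p2;
  ab_kernel : forall (X Y : ab_pre) (f : hom X Y),
    exists K (k : hom K X), is_kernel f k;
  ab_cokernel : forall (X Y : ab_pre) (f : hom X Y),
    exists Q (c : hom Y Q), is_cokernel f c;
  ab_mono_normal : forall (X Y : ab_pre) (f : hom X Y), is_mono f ->
    exists Z (g : hom Y Z), is_kernel g f;
  ab_epi_normal : forall (X Y : ab_pre) (f : hom X Y), is_epi f ->
    exists W (g : hom W X), is_cokernel g f }.

Definition short_exact (A : preadditive) (X Y Z : A) (f : hom X Y)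
    (g : hom Y Z) : Prop :=
  is_kernel g f /\ is_cokernel f g.

(* Such a functor is automatically additive: it preserves zero objects and
   split short exact sequences, hence biproducts. *)
Definition exact_functor (A B : preadditive) (F : functor A B) : Prop :=
  forall X Y Z (f : hom X Y) (g : hom Y Z),
    short_exact f g -> short_exact (fmap F f) (fmap F g).

Record monoidal (A : category) := Monoidal {
  tens : A -> A -> A;
  tensm : forall X X' Y Y' : A, hom X X' -> hom Y Y' ->
    hom (tens X Y) (tens X' Y');
  tensm1 : forall X Y, tensm (idm X) (idm Y) = idm (tens X Y);
  tensmM : forall X X' X'' Y Y' Y'' (g : hom X' X'') (f : hom X X')
      (g' : hom Y' Y'') (f' : hom Y Y'),
    tensm (g ∘ f) (g' ∘ f') = tensm g g' ∘ tensm f f';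
  tunit : A;
  tassoc : forall X Y Z, hom (tens (tens X Y) Z) (tens X (tens Y Z));
  tlunit : forall X, hom (tens tunit X) X;
  trunit : forall X, hom (tens X tunit) X;
  tassoc_iso : forall X Y Z, is_iso (tassoc X Y Z);
  tlunit_iso : forall X, is_iso (tlunit X);
  trunit_iso : forall X, is_iso (trunit X);
  tassoc_nat : forall X X' Y Y' Z Z' (f : hom X X') (g : hom Y Y')
      (h : hom Z Z'),
    tassoc X' Y' Z' ∘ tensm (tensm f g) h =
    tensm f (tensm g h) ∘ tassoc X Y Z;
  tlunit_nat : forall X X' (f : hom X X'),
    tlunit X' ∘ tensm (idm tunit) f = f ∘ tlunit X;
  trunit_nat : forall X X' (f : hom X X'),
    trunit X' ∘ tensm f (idm tunit) = f ∘ trunit X;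
  tpentagon : forall W X Y Z,
    tassoc W X (tens Y Z) ∘ tassoc (tens W X) Y Z =
    tensm (idm W) (tassoc X Y Z) ∘ tassoc W (tens X Y) Z
      ∘ tensm (tassoc W X Y) (idm Z);
  ttriangle : forall X Y,
    tensm (idm X) (tlunit Y) ∘ tassoc X tunit Y =
    tensm (trunit X) (idm Y) }.

Arguments tens {A} M X Y : rename.
Arguments tensm {A} M {X X' Y Y'} f g : rename.
Arguments tunit {A} M : rename.
Arguments tassoc {A} M X Y Z : rename.
Arguments tlunit {A} M X : rename.
Arguments trunit {A} M X : rename.

Record is_monoidal_structure (A B : category) (MA : monoidal A)
    (MB : monoidal B) (F : functor A B)
    (J : forall X Y : A, hom (tens MB (F X) (F Y)) (F (tens MA X Y)))
    (e : hom (tunit MB) (F (tunit MA))) : Prop := IsMonoidalStructure {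
  mf_J_iso : forall X Y, is_iso (J X Y);
  mf_e_iso : is_iso e;
  mf_J_nat : forall X X' Y Y' (f : hom X X') (g : hom Y Y'),
    fmap F (tensm MA f g) ∘ J X Y = J X' Y' ∘ tensm MB (fmap F f) (fmap F g);
  mf_assoc : forall X Y Z,
    fmap F (tassoc MA X Y Z) ∘ J (tens MA X Y) Z
      ∘ tensm MB (J X Y) (idm (F Z)) =
    J X (tens MA Y Z) ∘ tensm MB (idm (F X)) (J Y Z)
      ∘ tassoc MB (F X) (F Y) (F Z);
  mf_lunit : forall X,
    fmap F (tlunit MA X) ∘ J (tunit MA) X ∘ tensm MB e (idm (F X)) =
    tlunit MB (F X);
  mf_runit : forall X,
    fmap F (trunit MA X) ∘ J X (tunit MA) ∘ tensm MB (idm (F X)) e =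
    trunit MB (F X) }.

Definition is_monoidal_functor (A B : category) (MA : monoidal A)
    (MB : monoidal B) (F : functor A B) : Prop :=
  exists J e, @is_monoidal_structure A B MA MB F J e.

Lemma tensR_proof1 (A : category) (M : monoidal A) (X Y : A) :
  tensm M (idm Y) (idm X) = idm (tens M Y X).
Proof. exact: tensm1. Qed.

Lemma tensR_proof2 (A : category) (M : monoidal A) (X Y Y' Y'' : A)
    (g : hom Y' Y'') (f : hom Y Y') :
  tensm M (g ∘ f) (idm X) = tensm M g (idm X) ∘ tensm M f (idm X).
Proof. by rewrite -tensmM comp1m. Qed.

Lemma tensL_proof2 (A : category) (M : monoidal A) (X Y Y' Y'' : A)
    (g : hom Y' Y'') (f : hom Y Y') :
  tensm M (idm X) (g ∘ f) = tensm M (idm X) g ∘ tensm M (idm X) f.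
Proof. by rewrite -tensmM comp1m. Qed.

(** [tensR M X] is [- ⊗ X] and [tensL M X] is [X ⊗ -]. *)
Definition tensR (A : category) (M : monoidal A) (X : A) : functor A A :=
  @Functor A A (fun Y => tens M Y X) (fun _ _ f => tensm M f (idm X))
    (tensR_proof1 M X) (fun Y Y' Y'' g f => tensR_proof2 M X g f).

Definition tensL (A : category) (M : monoidal A) (X : A) : functor A A :=
  @Functor A A (tens M X) (fun _ _ f => tensm M (idm X) f)
    (fun Y => tensR_proof1 M Y X) (fun Y Y' Y'' g f => tensL_proof2 M X g f).

Definition biexact (A : preadditive) (M : monoidal A) : Prop :=
  forall X : A, exact_functor (tensR M X) /\ exact_functor (tensL M X).

(* A full subcategory is given by its class of objects; closure under
   isomorphism is part of closure under subobjects. *)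
Record serre_subcategory (A : abelian) (C : A -> Prop) : Prop :=
  SerreSubcategory {
  serre_zero : forall Z, is_zero_object Z -> C Z;
  serre_sum : forall X Y P (i1 : hom X P) (i2 : hom Y P) (p1 : hom P X)
      (p2 : hom P Y), is_biproduct i1 i2 p1 p2 -> C X -> C Y -> C P;
  serre_sub : forall X Y (i : hom X Y), is_mono i -> C Y -> C X;
  serre_quo : forall X Y (q : hom X Y), is_epi q -> C X -> C Y;
  serre_ext : forall X Y Z (f : hom X Y) (g : hom Y Z),
    short_exact f g -> C X -> C Z -> C Y }.

Record serre_tensor_ideal (A : abelian) (M : monoidal A) (C : A -> Prop)
    : Prop := SerreTensorIdeal {
  ideal_serre :> serre_subcategory C;
  ideal_tensL : forall X Y, C Y -> C (tens M X Y);
  ideal_tensR : forall X Y, C Y -> C (tens M Y X) }.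

Definition kernel_in (A : preadditive) (C : A -> Prop) (X Y : A)
    (f : hom X Y) : Prop :=
  exists K (k : hom K X), is_kernel f k /\ C K.

Definition cokernel_in (A : preadditive) (C : A -> Prop) (X Y : A)
    (f : hom X Y) : Prop :=
  exists Q (c : hom Y Q), is_cokernel f c /\ C Q.

(** An element [f : M' -> N/N'] of the direct system computing the maps from
    [M] to [N] in A/C.  The subobject [M'] is given by a monomorphism into [M]
    with cokernel in [C]; the subobject [N'], by the quotient map
    [N -> N/N'], an epimorphism with kernel [N'] in [C]. *)
Record premor (A : abelian) (C : A -> Prop) (M N : A) := Premor {
  pm_sub : A;
  pm_incl : hom pm_sub M;
  pm_incl_mono : is_mono pm_incl;
  pm_incl_in : cokernel_in C pm_incl;
  pm_quo : A;
  pm_proj : hom N pm_quo;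
  pm_proj_epi : is_epi pm_proj;
  pm_proj_in : kernel_in C pm_proj;
  pm_map : hom pm_sub pm_quo }.

HB.instance Definition _ (A : abelian) (C : A -> Prop) (M N : A) :=
  gen_eqMixin (premor C M N).
HB.instance Definition _ (A : abelian) (C : A -> Prop) (M N : A) :=
  gen_choiceMixin (premor C M N).

(** [pm_restricts f g]: [g] is the image of [f] under a transition map of the
    direct system, i.e. the index of [g] has a smaller subobject of [M] and a
    larger subobject of [N], and [g] is the induced map. *)
Definition pm_restricts (A : abelian) (C : A -> Prop) (M N : A)
    (f g : premor C M N) : Prop :=
  exists (u : hom (pm_sub g) (pm_sub f)) (v : hom (pm_quo f) (pm_quo g)),
    [/\ pm_incl f ∘ u = pm_incl g, v ∘ pm_proj f = pm_proj g
      & v ∘ pm_map f ∘ u = pm_map g].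

Definition pm_equiv (A : abelian) (C : A -> Prop) (M N : A)
    (f g : premor C M N) : Prop :=
  exists h, pm_restricts f h /\ pm_restricts g h.

Section PreadditiveFacts.
Variable A : preadditive.
Implicit Types X Y Z W K I M N P Q V : A.

Definition subm X Y (f g : hom X Y) : hom X Y := addm f (oppm g).

Lemma addmI X Y (f : hom X Y) g h : addm f g = addm f h -> g = h.
Proof. by move=> E; rewrite -[g]add0m -(addNm f) -addmA E addmA addNm add0m. Qed.

Lemma addm0 X Y (f : hom X Y) : addm f zerom = f.
Proof. by rewrite addmC add0m. Qed.

Lemma subm_eq0 X Y (f g : hom X Y) : subm f g = zerom <-> f = g.
Proof.
split=> [E|->]; last by rewrite /subm addmC addNm.
by apply: (@addmI _ _ (oppm g)); rewrite addNm addmC.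
Qed.

Lemma compm0 X Y Z (f : hom Y Z) : f ∘ (zerom : hom X Y) = zerom.
Proof. by apply: (@addmI _ _ (f ∘ zerom)); rewrite -compDr !addm0. Qed.

Lemma comp0m X Y Z (f : hom X Y) : (zerom : hom Y Z) ∘ f = zerom.
Proof. by apply: (@addmI _ _ (zerom ∘ f)); rewrite -compDl !addm0. Qed.

Lemma compNr X Y Z (g : hom Y Z) (f : hom X Y) : g ∘ oppm f = oppm (g ∘ f).
Proof.
apply: (@addmI _ _ (g ∘ f)); rewrite -compDr [addm f _]addmC addNm compm0.
by rewrite addmC addNm.
Qed.

Lemma compNl X Y Z (g : hom Y Z) (f : hom X Y) : oppm g ∘ f = oppm (g ∘ f).
Proof.
apply: (@addmI _ _ (g ∘ f)); rewrite -compDl [addm g _]addmC addNm comp0m.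
by rewrite addmC addNm.
Qed.

Lemma compBr X Y Z (g : hom Y Z) (f f' : hom X Y) :
  g ∘ subm f f' = subm (g ∘ f) (g ∘ f').
Proof. by rewrite /subm compDr compNr. Qed.

Lemma compBl X Y Z (g g' : hom Y Z) (f : hom X Y) :
  subm g g' ∘ f = subm (g ∘ f) (g' ∘ f).
Proof. by rewrite /subm compDl compNl. Qed.

Lemma mono_ker0 X Y (f : hom X Y) :
  (forall W (u : hom W X), f ∘ u = zerom -> u = zerom) -> is_mono f.
Proof.
move=> H W u v E; apply/subm_eq0/H; rewrite compBr; exact/subm_eq0.
Qed.

Lemma epi_coker0 X Y (f : hom X Y) :
  (forall W (u : hom Y W), u ∘ f = zerom -> u = zerom) -> is_epi f.
Proof.
move=> H W u v E; apply/subm_eq0/H; rewrite compBl; exact/subm_eq0.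
Qed.

Lemma mono0 X Y W (f : hom X Y) (u : hom W X) :
  is_mono f -> f ∘ u = zerom -> u = zerom.
Proof. by move=> H E; apply: H; rewrite E compm0. Qed.

Lemma epi0 X Y W (f : hom X Y) (u : hom Y W) :
  is_epi f -> u ∘ f = zerom -> u = zerom.
Proof. by move=> H E; apply: H; rewrite E comp0m. Qed.

Lemma mono_comp X Y Z (g : hom Y Z) (f : hom X Y) :
  is_mono g -> is_mono f -> is_mono (g ∘ f).
Proof. by move=> mg mf W u v; rewrite -!compA => /mg/mf. Qed.

Lemma epi_comp X Y Z (g : hom Y Z) (f : hom X Y) :
  is_epi g -> is_epi f -> is_epi (g ∘ f).
Proof. by move=> eg ef W u v; rewrite !compA => /ef/eg. Qed.

Lemma mono_id X : is_mono (idm X).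
Proof. by move=> W u v; rewrite !comp1m. Qed.

Lemma epi_id X : is_epi (idm X).
Proof. by move=> W u v; rewrite !compm1. Qed.

Lemma mono_compr X Y Z (g : hom Y Z) (f : hom X Y) :
  is_mono (g ∘ f) -> is_mono f.
Proof. by move=> m W u v E; apply: m; rewrite -!compA E. Qed.

Lemma epi_compl X Y Z (g : hom Y Z) (f : hom X Y) :
  is_epi (g ∘ f) -> is_epi g.
Proof. by move=> m W u v E; apply: m; rewrite !compA E. Qed.

Lemma kernel_mono K X Y (f : hom X Y) (k : hom K X) : is_kernel f k -> is_mono k.
Proof.
move=> [fk U] W u v E.
have /U [w [_ wU]] : f ∘ (k ∘ u) = zerom by rewrite compA fk comp0m.
by rewrite -(wU u) // -(wU v).
Qed.

Lemma cokernel_epi X Y Q (f : hom X Y) (c : hom Y Q) : is_cokernel f c -> is_epi c.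
Proof.
move=> [fk U] W u v E.
have /U [w [_ wU]] : (u ∘ c) ∘ f = zerom by rewrite -compA fk compm0.
by rewrite -(wU u) // -(wU v).
Qed.

Lemma kernelP K X Y (f : hom X Y) (k : hom K X) :
  is_mono k -> f ∘ k = zerom ->
  (forall W (x : hom W X), f ∘ x = zerom -> exists u, k ∘ u = x) ->
  is_kernel f k.
Proof.
move=> mk fk H; split=> // W x /H [u Eu]; exists u; split=> // v Ev.
by apply: mk; rewrite Eu Ev.
Qed.

Lemma cokernelP X Y Q (f : hom X Y) (c : hom Y Q) :
  is_epi c -> c ∘ f = zerom ->
  (forall W (x : hom Y W), x ∘ f = zerom -> exists u, u ∘ c = x) ->
  is_cokernel f c.
Proof.
move=> mk fk H; split=> // W x /H [u Eu]; exists u; split=> // v Ev.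
by apply: mk; rewrite Eu Ev.
Qed.

Lemma kernel_lift K X Y W (f : hom X Y) (k : hom K X) (x : hom W X) :
  is_kernel f k -> f ∘ x = zerom -> exists u, k ∘ u = x.
Proof. by move=> [_ H] /H [u [E _]]; exists u. Qed.

Lemma cokernel_desc X Y Q W (f : hom X Y) (c : hom Y Q) (x : hom Y W) :
  is_cokernel f c -> x ∘ f = zerom -> exists u, u ∘ c = x.
Proof. by move=> [_ H] /H [u [E _]]; exists u. Qed.

Lemma zero_objectP Z : idm Z = zerom -> is_zero_object Z.
Proof.
move=> E; split=> X; exists zerom; split=> // f _.
  by rewrite -[f]compm1 E compm0.
by rewrite -[f]comp1m E comp0m.
Qed.

Lemma kernel_monol K X Y Z (f : hom X Y) (m : hom Y Z) (k : hom K X) :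
  is_mono m -> is_kernel (m ∘ f) k <-> is_kernel f k.
Proof.
move=> mm; split=> H; apply: kernelP (kernel_mono H) _ _.
- by apply: (mono0 mm); rewrite compA; case: H.
- by move=> W x E; apply: (kernel_lift H); rewrite -compA E compm0.
- by case: H => E _; rewrite -compA E compm0.
- by move=> W x; rewrite -compA => /(mono0 mm); apply: kernel_lift.
Qed.

Lemma cokernel_epir X Y Z Q (f : hom X Y) (e : hom Z X) (c : hom Y Q) :
  is_epi e -> is_cokernel (f ∘ e) c <-> is_cokernel f c.
Proof.
move=> mm; split=> H; apply: cokernelP (cokernel_epi H) _ _.
- by apply: (epi0 mm); rewrite -compA; case: H.
- by move=> W x E; apply: (cokernel_desc H); rewrite compA E comp0m.
- by case: H => E _; rewrite compA E comp0m.
- by move=> W x; rewrite compA => /(epi0 mm); apply: cokernel_desc.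
Qed.

End PreadditiveFacts.

Section AbelianFacts.
Variable A : abelian.
Implicit Types X Y Z W K I M N P Q V : A.

Lemma epi_cokernel X Y K (e : hom X Y) (k : hom K X) :
  is_epi e -> is_kernel e k -> is_cokernel k e.
Proof.
move=> ee ke; have [W [s cs]] := ab_epi_normal ee.
apply: cokernelP => //; first by case: ke.
have [t Et] : exists t, k ∘ t = s by apply: kernel_lift ke _; case: cs.
move=> V x E; apply: (cokernel_desc cs).
by rewrite -Et compA E comp0m.
Qed.

Lemma mono_kernel X Y Q (m : hom X Y) (c : hom Y Q) :
  is_mono m -> is_cokernel m c -> is_kernel c m.
Proof.
move=> mm cm; have [W [s cs]] := ab_mono_normal mm.
apply: kernelP => //; first by case: cm.
have [t Et] : exists t, t ∘ c = s by apply: cokernel_desc cm _; case: cs.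
move=> V x E; apply: (kernel_lift cs).
by rewrite -Et -compA E compm0.
Qed.

Lemma image X Y (f : hom X Y) :
  exists I (e : hom X I) (m : hom I Y), [/\ is_epi e, is_mono m & f = m ∘ e].
Proof.
have [Q [c cc]] := ab_cokernel f.
have [I [m km]] := ab_kernel c.
have mm := kernel_mono km.
have [e E] : exists e, m ∘ e = f by apply: kernel_lift km _; case: cc.
exists I, e, m; split=> //; apply: epi_coker0 => Z g ge.
have [K [k kk]] := ab_kernel g.
have [e' Ee'] := kernel_lift kk ge.
have [V [h kh]] := ab_mono_normal (mono_comp mm (kernel_mono kk)).
have [h' Eh'] : exists h', h' ∘ c = h.
  apply: cokernel_desc cc _; rewrite -E -Ee' !compA -(compA h).
  by case: kh => -> _; rewrite comp0m.
have [r Er] : exists r, m ∘ k ∘ r = m.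
  apply: kernel_lift kh _; rewrite -Eh' -compA.
  by case: km => -> _; rewrite compm0.
have kr : k ∘ r = idm I by apply: mm; rewrite compA Er compm1.
by rewrite -[g]compm1 -kr compA; case: kk => -> _; rewrite comp0m.
Qed.

Lemma image_kernel X Y I (e : hom X I) (m : hom I Y) K (k : hom K X) :
  is_mono m -> is_kernel (m ∘ e) k -> is_kernel e k.
Proof. by move=> mm /(kernel_monol _ _ mm). Qed.

Lemma pullback_mono M' M V Q (i : hom M' M) (c : hom M Q) (x : hom V M) :
  is_mono i -> is_cokernel i c ->
  exists P (p : hom P V) (w : hom P M'), i ∘ w = x ∘ p /\ is_kernel (c ∘ x) p.
Proof.
move=> mi ci; have [P [p kp]] := ab_kernel (c ∘ x).
have [w Ew] : exists w, i ∘ w = x ∘ p.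
  by apply: kernel_lift (mono_kernel mi ci) _; rewrite compA; case: kp.
by exists P, p, w.
Qed.

Lemma pullback_epi N W Q (q : hom N Q) (y : hom W Q) :
  is_epi q ->
  exists P (p : hom P W) (w : hom P N),
    [/\ q ∘ w = y ∘ p, is_epi p &
        forall V (u : hom V P), w ∘ u = zerom -> p ∘ u = zerom -> u = zerom].
Proof.
move=> eq; have [S [i1 [i2 [p1 [p2 [E11 E22 E12 E21 ES]]]]]] := ab_biproduct N W.
pose d := subm (q ∘ p1) (y ∘ p2).
have di1 : d ∘ i1 = q.
  by rewrite compBl -!compA E11 E21 compm0 compm1 -[RHS]addm0 /subm;
     congr (addm _ _); apply: (@addmI _ _ _ zerom); rewrite addmC addNm addm0.
have ed : is_epi d by apply: (@epi_compl _ _ _ _ d i1); rewrite di1.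
have [P [k kk]] := ab_kernel d.
exists P, (p2 ∘ k), (p1 ∘ k); split.
- by apply/subm_eq0; rewrite !compA -compBl; case: kk.
- apply: epi_coker0 => Z g gE.
  have [g' Eg'] : exists g', g' ∘ d = g ∘ p2.
    by apply: cokernel_desc (epi_cokernel ed kk) _; rewrite -compA.
  have g'0 : g' = zerom.
    by apply: (epi0 eq); rewrite -di1 compA Eg' -compA E21 compm0.
  by rewrite -[g]compm1 -E22 compA -Eg' g'0 !comp0m.
- move=> V u E1 E2; apply: (mono0 (kernel_mono kk)).
  rewrite -[k ∘ u]comp1m -ES compDl -!compA [p1 ∘ _]compA [p2 ∘ _]compA E1 E2.
  by rewrite !compm0 addm0.
Qed.

End AbelianFacts.

Definition isoC (A : preadditive) (C : A -> Prop) (X Y : A) (f : hom X Y)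
    : Prop :=
  kernel_in C f /\ cokernel_in C f.

Section Serre.
Variables (A : abelian) (C : A -> Prop) (hC : serre_subcategory C).
Implicit Types X Y Z W M N P Q K V : A.
Local Notation kernel_in := (kernel_in C).
Local Notation cokernel_in := (cokernel_in C).
Local Notation isoC := (isoC C).

Lemma kernel_inP X Y K (f : hom X Y) (k : hom K X) :
  is_kernel f k -> kernel_in f -> C K.
Proof.
move=> kk [K' [k' [kk' CK']]].
have [u Eu] : exists u, k' ∘ u = k by apply: kernel_lift kk' _; case: kk.
apply: (serre_sub hC _ CK'); apply: (@mono_compr _ _ _ _ k' u).
by rewrite Eu; apply: kernel_mono kk.
Qed.

Lemma cokernel_inP X Y Q (f : hom X Y) (c : hom Y Q) :
  is_cokernel f c -> cokernel_in f -> C Q.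
Proof.
move=> kk [K' [k' [kk' CK']]].
have [u Eu] : exists u, u ∘ k' = c by apply: cokernel_desc kk' _; case: kk.
apply: (serre_quo hC _ CK'); apply: (@epi_compl _ _ _ _ u k').
by rewrite Eu; apply: cokernel_epi kk.
Qed.

Lemma mono_kernel_in X Y (f : hom X Y) : is_mono f -> kernel_in f.
Proof.
move=> mf; have [K [k kk]] := ab_kernel f; exists K, k; split=> //.
apply: (serre_zero hC); apply: zero_objectP; apply: (kernel_mono kk).
by rewrite compm0 compm1; apply: (mono0 mf); case: kk.
Qed.

Lemma epi_cokernel_in X Y (f : hom X Y) : is_epi f -> cokernel_in f.
Proof.
move=> mf; have [K [k kk]] := ab_cokernel f; exists K, k; split=> //.
apply: (serre_zero hC); apply: zero_objectP; apply: (cokernel_epi kk).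
by rewrite comp0m comp1m; apply: (epi0 mf); case: kk.
Qed.

Lemma kernel_in_ext Y Z (g : hom Y Z) : kernel_in g -> C Z -> C Y.
Proof.
move=> [K [k [kk CK]]] CZ; have [I [e [m [ee mm E]]]] := image g.
rewrite E in kk; have ke := image_kernel mm kk.
apply: (serre_ext hC (f := k) (g := e)) => //; last exact: serre_sub mm _.
by split=> //; apply: epi_cokernel.
Qed.

Lemma cokernel_in_ext X Y (f : hom X Y) : cokernel_in f -> C X -> C Y.
Proof.
move=> [Q [c [cc CQ]]] CX; have [I [e [m [ee mm E]]]] := image f.
have cm : is_cokernel m c by rewrite E in cc; apply/(cokernel_epir _ _ ee).
apply: (serre_ext hC (f := m) (g := c)) => //; last exact: serre_quo ee _.
by split=> //; apply: mono_kernel.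
Qed.

Lemma kernel_in_comp X Y Z (g : hom Y Z) (f : hom X Y) :
  kernel_in g -> kernel_in f -> kernel_in (g ∘ f).
Proof.
move=> [L [l [ll CL]]] Kf; have [K [k kk]] := ab_kernel (g ∘ f).
exists K, k; split=> //.
have [u Eu] : exists u, l ∘ u = f ∘ k.
  by apply: kernel_lift ll _; rewrite compA; case: kk.
have [V [v kv]] := ab_kernel u.
apply: (@kernel_in_ext _ _ u) CL; exists V, v; split=> //.
have [K' [k' [kk' CK']]] := Kf.
have [w Ew] : exists w, k' ∘ w = k ∘ v.
  by apply: kernel_lift kk' _; rewrite compA -Eu -compA; case: kv => -> _;
     rewrite compm0.
apply: (serre_sub hC _ CK'); apply: (@mono_compr _ _ _ _ k' w); rewrite Ew.
by apply: mono_comp; [apply: kernel_mono kk | apply: kernel_mono kv].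
Qed.

Lemma cokernel_in_comp X Y Z (g : hom Y Z) (f : hom X Y) :
  cokernel_in g -> cokernel_in f -> cokernel_in (g ∘ f).
Proof.
move=> Kg [L [l [ll CL]]]; have [K [k kk]] := ab_cokernel (g ∘ f).
exists K, k; split=> //.
have [u Eu] : exists u, u ∘ l = k ∘ g.
  by apply: cokernel_desc ll _; rewrite -compA; case: kk.
have [V [v kv]] := ab_cokernel u.
apply: (@cokernel_in_ext _ _ u) CL; exists V, v; split=> //.
have [K' [k' [kk' CK']]] := Kg.
have [w Ew] : exists w, w ∘ k' = v ∘ k.
  by apply: cokernel_desc kk' _; rewrite -compA -Eu compA; case: kv => -> _;
     rewrite comp0m.
apply: (serre_quo hC _ CK'); apply: (@epi_compl _ _ _ _ w k'); rewrite Ew.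
by apply: epi_comp; [apply: cokernel_epi kv | apply: cokernel_epi kk].
Qed.

Lemma isoC_comp X Y Z (g : hom Y Z) (f : hom X Y) :
  isoC g -> isoC f -> isoC (g ∘ f).
Proof.
by move=> [? ?] [? ?]; split; [apply: kernel_in_comp | apply: cokernel_in_comp].
Qed.

Lemma isoC_mono X Y (f : hom X Y) : is_mono f -> cokernel_in f -> isoC f.
Proof. by move=> /mono_kernel_in. Qed.

Lemma isoC_epi X Y (f : hom X Y) : is_epi f -> kernel_in f -> isoC f.
Proof. by move=> /epi_cokernel_in. Qed.

Lemma isoC_id X : isoC (idm X).
Proof.
by split; [apply: mono_kernel_in; apply: mono_id
          | apply: epi_cokernel_in; apply: epi_id].
Qed.

Lemma isoC_image X Y (f : hom X Y) : isoC f ->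
  exists I (e : hom X I) (m : hom I Y),
    [/\ is_epi e /\ kernel_in e, is_mono m /\ cokernel_in m & f = m ∘ e].
Proof.
move=> [[K [k [kk CK]]] [Q [c [cc CQ]]]].
have [I [e [m [ee mm E]]]] := image f; exists I, e, m; split=> //; split=> //.
  by exists K, k; split=> //; rewrite E in kk; apply: image_kernel kk.
by exists Q, c; split=> //; rewrite E in cc; apply/(cokernel_epir _ _ ee).
Qed.

Lemma isoC_pullback_mono M' M V (i : hom M' M) (x : hom V M) :
  is_mono i -> cokernel_in i ->
  exists P (p : hom P V) (w : hom P M'),
    [/\ i ∘ w = x ∘ p, is_mono p & cokernel_in p].
Proof.
move=> mi [Q [c [cc CQ]]]; have [P [p [w [E kp]]]] := pullback_mono x mi cc.
exists P, p, w; split=> //; first exact: kernel_mono kp.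
have [I [e [m [ee mm Em]]]] := image (c ∘ x); exists I, e; split.
  by apply: epi_cokernel => //; rewrite Em in kp; apply: image_kernel kp.
exact: serre_sub mm CQ.
Qed.

Lemma isoC_pullback_epi N W Q (q : hom N Q) (y : hom W Q) :
  is_epi q -> kernel_in q ->
  exists P (p : hom P W) (w : hom P N), q ∘ w = y ∘ p /\ isoC p.
Proof.
move=> eq [K [k [kk CK]]]; have [P [p [w [E ep J]]]] := pullback_epi y eq.
exists P, p, w; split=> //; apply: isoC_epi => //.
have [L [l kl]] := ab_kernel p; exists L, l; split=> //.
have [u Eu] : exists u, k ∘ u = w ∘ l.
  by apply: kernel_lift kk _; rewrite compA E -compA; case: kl => -> _;
     rewrite compm0.
apply: (serre_sub hC _ CK); apply: (@mono_ker0 _ _ _ u) => V v uv.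
apply: (mono0 (kernel_mono kl)); apply: J.
  by rewrite compA -Eu -compA uv compm0.
by rewrite compA; case: kl => -> _; rewrite comp0m.
Qed.

Lemma isoC_ore M V W (s : hom W M) (x : hom V M) : isoC s ->
  exists U (t : hom U V) (w : hom U W), s ∘ w = x ∘ t /\ isoC t.
Proof.
move=> /isoC_image [I [e [m [[ee ke] [mm cm] ->]]]].
have [P [p [w [E mp cp]]]] := isoC_pullback_mono x mm cm.
have [U [t [w' [E' st]]]] := isoC_pullback_epi w ee ke.
exists U, (p ∘ t), w'; split; first by rewrite -compA E' !compA E.
by apply: isoC_comp => //; apply: isoC_mono.
Qed.

Lemma isoC_equalize W N Q (q : hom N Q) (y y' : hom W N) : kernel_in q ->
  q ∘ y = q ∘ y' -> exists V (s : hom V W), isoC s /\ y ∘ s = y' ∘ s.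
Proof.
move=> [K [k [kk CK]]] E.
have [u Eu] : exists u, k ∘ u = subm y y'.
  by apply: kernel_lift kk _; rewrite compBr; apply/subm_eq0.
have [V [s ks]] := ab_kernel u; exists V, s; split.
  apply: isoC_mono; first exact: kernel_mono ks.
  have [I [e [m [ee mm Em]]]] := image u; exists I, e; split.
    by apply: epi_cokernel => //; rewrite Em in ks; apply: image_kernel ks.
  exact: serre_sub mm CK.
apply/subm_eq0; rewrite -compBl -Eu -compA.
by case: ks => -> _; rewrite compm0.
Qed.

(** [graph f x y]: the generalized element [x] of [M] lies in the domain of
    [f], and [y] lifts its image under [f] to [N]. *)
Definition graph M N (f : premor C M N) W (x : hom W M) (y : hom W N) : Prop :=
  exists a, pm_incl f ∘ a = x /\ pm_proj f ∘ y = pm_map f ∘ a.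

Lemma graph_comp M N (f : premor C M N) W V (x : hom W M) (y : hom W N)
    (u : hom V W) : graph f x y -> graph f (x ∘ u) (y ∘ u).
Proof.
by move=> [a [<- E]]; exists (a ∘ u); rewrite !compA E.
Qed.

Lemma graph_total M N (f : premor C M N) W (x : hom W M) :
  exists V (s : hom V W) y, isoC s /\ graph f (x ∘ s) y.
Proof.
have [P [p [a [E mp cp]]]] :=
  isoC_pullback_mono x (@pm_incl_mono _ _ _ _ f) (@pm_incl_in _ _ _ _ f).
have [V [t [y [E' st]]]] :=
  isoC_pullback_epi (pm_map f ∘ a) (@pm_proj_epi _ _ _ _ f) (@pm_proj_in _ _ _ _ f).
exists V, (p ∘ t), y; split.
  by apply: isoC_comp => //; apply: isoC_mono.
by exists (a ∘ t); rewrite !compA E E'.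
Qed.

Lemma graph_fun M N (f : premor C M N) W (x : hom W M) y y' :
  graph f x y -> graph f x y' ->
  exists V (s : hom V W), isoC s /\ y ∘ s = y' ∘ s.
Proof.
move=> [a [Ea E]] [a' [Ea' E']].
have aa : a = a' by apply: (@pm_incl_mono _ _ _ _ f); rewrite Ea.
by apply: isoC_equalize (@pm_proj_in _ _ _ _ f) _; rewrite E E' aa.
Qed.

Lemma graph_dom M N (f : premor C M N) W (s : hom W M) z V (x : hom V M) y :
  isoC s -> graph f s z -> graph f x y ->
  exists U (t : hom U V) (w : hom U W),
    [/\ isoC t, x ∘ t = s ∘ w & y ∘ t = z ∘ w].
Proof.
move=> ss gs gx; have [U [t [w [E st]]]] := isoC_ore x ss.
have g1 := graph_comp t gx; have := graph_comp w gs.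
rewrite E => /(graph_fun g1) [U' [t' [st' E']]].
exists U', (t ∘ t'), (w ∘ t'); rewrite !compA E E'.
by split=> //; apply: isoC_comp.
Qed.

Lemma graph_equiv M N (f g : premor C M N) W (s : hom W M) y :
  isoC s -> graph f s y -> graph g s y -> pm_equiv f g.
Proof.
move=> ss [a [Ea Ef]] [b [Eb Eg]].
have [I [e [i [[ee _] [mi ci] Es]]]] := isoC_image ss.
have [K [k ke]] := ab_kernel e.
have ek : e ∘ k = zerom by case: ke.
have ce := epi_cokernel ee ke.
have [u1 Eu1] : exists u, u ∘ e = a.
  apply: cokernel_desc ce _; apply: (mono0 (@pm_incl_mono _ _ _ _ f)).
  by rewrite compA Ea Es -compA ek compm0.
have [u2 Eu2] : exists u, u ∘ e = b.
  apply: cokernel_desc ce _; apply: (mono0 (@pm_incl_mono _ _ _ _ g)).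
  by rewrite compA Eb Es -compA ek compm0.
have [K1 [k1 [kk1 CK1]]] := @pm_proj_in _ _ _ _ f.
have [Q [c cc]] := ab_cokernel (pm_proj g ∘ k1).
have ec := cokernel_epi cc.
have [v Ev] : exists v, v ∘ pm_proj f = c ∘ pm_proj g.
  apply: cokernel_desc (epi_cokernel (@pm_proj_epi _ _ _ _ f) kk1) _.
  by rewrite -compA; case: cc.
have kc : kernel_in c.
  have [J [e' [m [ee' mm Em]]]] := image (pm_proj g ∘ k1); rewrite Em in cc.
  exists J, m; split; last exact: serre_quo ee' CK1.
  by apply: mono_kernel => //; apply/(cokernel_epir _ _ ee').
have h1 : is_epi (c ∘ pm_proj g) by apply: epi_comp => //; apply: pm_proj_epi.
have h2 : kernel_in (c ∘ pm_proj g) by apply: kernel_in_comp => //; apply: pm_proj_in.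
exists (Premor mi ci h1 h2 (c ∘ pm_map g ∘ u2)); split.
  exists u1, v; split=> //=; first by apply: ee; rewrite -compA Eu1 Ea.
  by apply: ee; rewrite -!compA Eu1 Eu2 -Ef -Eg !compA Ev.
by exists u2, c; split=> //=; apply: ee; rewrite -compA Eu2 Eb.
Qed.

Lemma equiv_graph M N (f g : premor C M N) : pm_equiv f g ->
  exists W (s : hom W M) y, [/\ isoC s, graph f s y & graph g s y].
Proof.
move=> [h [[u1 [v1 [i1 q1 m1]]] [u2 [v2 [i2 q2 m2]]]]].
have [W [s [y [ss [a [Ea E]]]]]] := graph_total f (pm_incl h).
have {}Ea : a = u1 ∘ s.
  by apply: (@pm_incl_mono _ _ _ _ f); rewrite Ea compA i1.
have sh : isoC (pm_incl h) by apply: isoC_mono; [apply: pm_incl_mono | apply: pm_incl_in].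
have kv : kernel_in v2.
  have [K [k kk]] := ab_kernel v2; exists K, k; split=> //.
  have [P [p [w [E' ep _]]]] := pullback_epi k (@pm_proj_epi _ _ _ _ g).
  have [L [l [ll CL]]] := @pm_proj_in _ _ _ _ h.
  have [r Er] : exists r, l ∘ r = w.
    apply: kernel_lift ll _; rewrite -q2 -compA E' compA.
    by case: kk => -> _; rewrite comp0m.
  have [J [e [m [ee mm Em]]]] := image (pm_proj g ∘ l).
  have CJ : C J by exact: serre_quo ee CL.
  have [c [d dd]] := ab_cokernel m.
  have [t Et] : exists t, m ∘ t = k.
    apply: kernel_lift (mono_kernel mm dd) _; apply: (epi0 ep).
    rewrite -compA -E' -Er [pm_proj g ∘ _]compA Em !compA.
    by case: dd => -> _; rewrite !comp0m.
  apply: (serre_sub hC _ CJ); apply: (@mono_compr _ _ _ _ m t).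
  by rewrite Et; apply: kernel_mono kk.
have [V [t [st Et]]] : exists V (t : hom V W), isoC t /\
    pm_proj g ∘ y ∘ t = pm_map g ∘ u2 ∘ s ∘ t.
  apply: isoC_equalize kv _.
  by rewrite !compA m2 q2 -q1 -m1 -!compA E Ea.
exists V, (pm_incl h ∘ s ∘ t), (y ∘ t); split.
- by apply: isoC_comp => //; apply: isoC_comp.
- by exists (u1 ∘ s ∘ t); rewrite !compA i1 E Ea !compA.
- by exists (u2 ∘ s ∘ t); rewrite !compA i2 Et.
Qed.

Lemma graph_equiv_transfer M N (f g : premor C M N) V (x : hom V M) y :
  pm_equiv f g -> graph f x y ->
  exists U (t : hom U V), isoC t /\ graph g (x ∘ t) (y ∘ t).
Proof.
move=> /equiv_graph [W [s [z [ss gf gg]]]] gx.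
have [U [t [w [st Ex Ey]]]] := graph_dom ss gf gx.
by exists U, t; rewrite Ex Ey; split=> //; apply: graph_comp.
Qed.

Lemma pm_equiv_refl M N (f : premor C M N) : pm_equiv f f.
Proof.
by exists f; split; exists (idm _), (idm _); rewrite !compm1 !comp1m.
Qed.

Lemma pm_equiv_sym M N (f g : premor C M N) : pm_equiv f g -> pm_equiv g f.
Proof. by move=> [h [? ?]]; exists h. Qed.

Lemma pm_equiv_trans M N (f g h : premor C M N) :
  pm_equiv f g -> pm_equiv g h -> pm_equiv f h.
Proof.
move=> /equiv_graph [W [s [y [ss gf gg]]]] E.
have [U [t [st gh]]] := graph_equiv_transfer E gg.
apply: (@graph_equiv _ _ _ _ _ (s ∘ t) (y ∘ t)) => //; first exact: isoC_comp.
exact: graph_comp.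
Qed.

End Serre.

Definition is_pullback (A : category) (X Y Z P : A) (f : hom X Z)
    (g : hom Y Z) (a : hom P X) (b : hom P Y) : Prop :=
  f ∘ a = g ∘ b /\
  forall W (x : hom W X) (y : hom W Y), f ∘ x = g ∘ y ->
    exists! u : hom W P, a ∘ u = x /\ b ∘ u = y.

Definition is_pushout (A : category) (X Y Z P : A) (f : hom Z X)
    (g : hom Z Y) (a : hom X P) (b : hom Y P) : Prop :=
  a ∘ f = b ∘ g /\
  forall W (x : hom X W) (y : hom Y W), x ∘ f = y ∘ g ->
    exists! u : hom P W, u ∘ a = x /\ u ∘ b = y.

(** [pm_composite f g h]: for [f : M' -> N/N'] and [g : N'' -> P/P'], [h] is
    [f^-1(I) -> I -> (P/P')/g(N' ∩ N'')], where the object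
    [I = N''/(N' ∩ N'')] is the image of [N''] in [N/N']. *)
Definition pm_composite (A : abelian) (C : A -> Prop) (M N P : A)
    (f : premor C M N) (g : premor C N P) (h : premor C M P) : Prop :=
  exists I (e : hom (pm_sub g) I) (m : hom I (pm_quo f))
      (a : hom (pm_sub h) (pm_sub f)) (b : hom (pm_sub h) I)
      (c : hom I (pm_quo h)) (d : hom (pm_quo g) (pm_quo h)),
    [/\ [/\ is_epi e, is_mono m & m ∘ e = pm_proj f ∘ pm_incl g],
        is_pullback (pm_map f) m a b /\ pm_incl h = pm_incl f ∘ a,
        is_pushout e (pm_map g) c d /\ pm_proj h = d ∘ pm_proj g
      & pm_map h = c ∘ b].

Section Composition.
Variables (A : abelian) (C : A -> Prop) (hC : serre_subcategory C).
Implicit Types X Y Z W M N P Q K V : A.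

Lemma kernel_cokernel_in K X Y (f : hom X Y) (k : hom K X) :
  is_kernel f k -> C Y -> cokernel_in C k.
Proof.
move=> kk CY; have [I [e [m [ee mm Em]]]] := image f; exists I, e; split.
  by apply: epi_cokernel => //; rewrite Em in kk; apply: image_kernel kk.
exact: (serre_sub hC) mm CY.
Qed.

Lemma cokernel_kernel_in X Y Q (f : hom X Y) (c : hom Y Q) :
  is_cokernel f c -> C X -> kernel_in C c.
Proof.
move=> cc CX; have [I [e [m [ee mm Em]]]] := image f; rewrite Em in cc.
exists I, m; split; last exact: (serre_quo hC) ee CX.
by apply: mono_kernel => //; apply/(cokernel_epir _ _ ee).
Qed.

Lemma pm_composite_ex M N P (f : premor C M N) (g : premor C N P) :
  exists h, pm_composite f g h.
Proof.
have sqj : isoC C (pm_proj f ∘ pm_incl g).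
  apply: (isoC_comp hC).
    by apply: (isoC_epi hC); [apply: pm_proj_epi | apply: pm_proj_in].
  by apply: (isoC_mono hC); [apply: pm_incl_mono | apply: pm_incl_in].
have [I [e [m [[ee [K [k [kk CK]]]] [mm [Q [c0 [cc CQ]]]] E]]]] := isoC_image sqj.
have [M1 [a [b [Eab ka]]]] := pullback_mono (pm_map f) mm cc.
have [P1 [d cd]] := ab_cokernel (pm_map g ∘ k).
have [c Ec] : exists c, c ∘ e = d ∘ pm_map g.
  by apply: cokernel_desc (epi_cokernel ee kk) _; rewrite -compA; case: cd.
have h1 : is_mono (pm_incl f ∘ a).
  by apply: mono_comp (kernel_mono ka); apply: pm_incl_mono.
have h2 : cokernel_in C (pm_incl f ∘ a).
  by apply: (cokernel_in_comp hC); [apply: pm_incl_in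
    | apply: kernel_cokernel_in ka CQ].
have h3 : is_epi (d ∘ pm_proj g).
  by apply: epi_comp (cokernel_epi cd) _; apply: pm_proj_epi.
have h4 : kernel_in C (d ∘ pm_proj g).
  by apply: (kernel_in_comp hC); [apply: cokernel_kernel_in cd CK
    | apply: pm_proj_in].
exists (Premor h1 h2 h3 h4 (c ∘ b)), I, e, m, a, b, c, d; split=> //=.
- split=> //; split=> // W x y Exy.
  have [u Eu] : exists u, a ∘ u = x.
    apply: kernel_lift ka _; rewrite -compA Exy compA.
    by case: cc => -> _; rewrite comp0m.
  exists u; split; last by move=> v [Ev _]; apply: (kernel_mono ka); rewrite Eu Ev.
  by split=> //; apply: mm; rewrite compA Eab -compA Eu.
- split=> //; split=> // W x y Exy.
  have [u Eu] : exists u, u ∘ d = y.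
    apply: cokernel_desc cd _; rewrite compA -Exy -compA.
    by case: kk => -> _; rewrite compm0.
  exists u; split; last by move=> v [_ Ev]; apply: (cokernel_epi cd); rewrite Eu Ev.
  by split=> //; apply: ee; rewrite -compA Ec compA Eu.
Qed.

(* Weaker than [pm_composite], but it still determines the class of [h]. *)
Definition graph_composite M N P (f : premor C M N) (g : premor C N P)
    (h : premor C M P) : Prop :=
  exists W (s : hom W M) y z,
    [/\ isoC C s, graph f s y, graph g y z & graph h s z].

Lemma pm_composite_graph M N P (f : premor C M N) (g : premor C N P) h :
  pm_composite f g h -> graph_composite f g h.
Proof.
move=> [I [e [m [a [b [c [d [[ee mm E] [[Eab _] Ei] [[Ecd _] Ep] Em]]]]]]]].
have [W [s [y [ss gy]]]] := graph_total hC f (pm_incl h).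
have [V [t [z [st gz]]]] := graph_total hC g y.
exists V, (pm_incl h ∘ s ∘ t), (y ∘ t), z; split=> //.
- apply: (isoC_comp hC) => //; apply: (isoC_comp hC) => //.
  by apply: (isoC_mono hC); [apply: pm_incl_mono | apply: pm_incl_in].
- exact: graph_comp.
exists (s ∘ t); split; first by rewrite compA.
have [n [En Ez]] := gz; have [a' [Ea' Ey]] := gy.
have {}Ea' : a' = a ∘ s.
  by apply: (@pm_incl_mono _ _ _ _ f); rewrite Ea' Ei compA.
rewrite Ep Em -compA Ez compA -Ecd -!compA; congr (c ∘ _).
apply: mm; rewrite [m ∘ (e ∘ n)]compA E -compA En.
by rewrite [LHS]compA Ey Ea' [pm_map f ∘ _]compA Eab -!compA.
Qed.

Lemma graph_composite_ge M N P (f : premor C M N) (g : premor C N P) h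
    W (x : hom W M) y z :
  graph_composite f g h -> graph f x y -> graph g y z ->
  exists V (t : hom V W), isoC C t /\ graph h (x ∘ t) (z ∘ t).
Proof.
move=> [W0 [s [y0 [z0 [ss gf gg gh]]]]] gx gy.
have [V [t [w [st Ex Ey]]]] := graph_dom hC ss gf gx.
have g1 := graph_comp t gy; have g2 := graph_comp w gg; rewrite Ey in g1.
have [U [t' [st' Ez]]] := graph_fun hC g1 g2.
exists U, (t ∘ t'); split; first exact: (isoC_comp hC).
by rewrite !compA Ez Ex -!compA; apply: graph_comp.
Qed.

Lemma graph_composite_equiv M N P (f f' : premor C M N) (g g' : premor C N P)
    h h' :
  pm_equiv f f' -> pm_equiv g g' ->
  graph_composite f g h -> graph_composite f' g' h' -> pm_equiv h h'.
Proof.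
move=> ef eg Ch [W [s [y [z [ss gf gg gh]]]]].
have [V [t [st gf']]] := graph_equiv_transfer hC (pm_equiv_sym ef) gf.
have gg' := graph_comp t gg.
have [U [t' [st' gg'']]] := graph_equiv_transfer hC (pm_equiv_sym eg) gg'.
have [U' [r [sr gr]]] := graph_composite_ge Ch (graph_comp t' gf') gg''.
apply: (graph_equiv hC _ gr).
  by do 3 apply: (isoC_comp hC) => //.
by rewrite -!compA; apply: graph_comp.
Qed.

Lemma graph_compositeA M N P Q (f : premor C M N) (g : premor C N P)
    (h : premor C P Q) gf hg k k' :
  graph_composite f g gf -> graph_composite g h hg ->
  graph_composite gf h k -> graph_composite f hg k' -> pm_equiv k k'.
Proof.
move=> C1 C2 C3 C4.
have [W [s [y [ss gy]]]] := graph_total hC f (idm M); rewrite comp1m in gy.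
have [V [t [z [st gz]]]] := graph_total hC g y.
have [U [r [w [sr gw]]]] := graph_total hC h z.
have fy := graph_comp r (graph_comp t gy); have gz' := graph_comp r gz.
have [U1 [t1 [st1 g1]]] := graph_composite_ge C1 fy gz'.
have [U2 [t2 [st2 g2]]] := graph_composite_ge C3 g1 (graph_comp t1 gw).
have [U3 [t3 [st3 g3]]] := graph_composite_ge C2 gz' gw.
have [U4 [t4 [st4 g4]]] := graph_composite_ge C4 (graph_comp t3 fy) g3.
have [U5 [p [q [E sp]]]] := isoC_ore hC (t1 ∘ t2) (isoC_comp hC st3 st4).
apply: (@graph_equiv _ _ hC _ _ _ _ _ (s ∘ t ∘ r ∘ t1 ∘ t2 ∘ p) (w ∘ t1 ∘ t2 ∘ p)).
- by do 5 apply: (isoC_comp hC) => //.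
- exact: graph_comp.
have := graph_comp q g4.
by rewrite -!compA [t3 ∘ _]compA E !compA.
Qed.

(** A morphism of A, with index [M' = M] and [N' = 0]. *)
Definition pm_of M N (f : hom M N) : premor C M N :=
  Premor (@mono_id A M) (isoC_id hC M).2 (@epi_id A N) (isoC_id hC N).1 f.

Lemma graph_of M N (f : hom M N) W (x : hom W M) y :
  graph (pm_of f) x y <-> y = f ∘ x.
Proof.
split=> [[a [/= <-]]|->]; first by rewrite !comp1m.
by exists x; rewrite !comp1m.
Qed.

End Composition.

Section QuotientCategory.
Variables (A : abelian) (C : A -> Prop) (hC : serre_subcategory C).
Implicit Types X Y Z W M N P Q : A.

(* The unused argument lets the canonical equivalence-relation structure on
   [pm_eqb], which depends on [hC], be inferred. *)
Definition pm_eqb of serre_subcategory C := fun M N (f g : premor C M N) =>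
  `[< pm_equiv f g >].

Lemma pm_eqb_refl M N : reflexive (@pm_eqb hC M N).
Proof. by move=> f; apply/asboolP/pm_equiv_refl. Qed.

Lemma pm_eqb_sym M N : symmetric (@pm_eqb hC M N).
Proof. by move=> f g; apply/asboolP/asboolP; apply: pm_equiv_sym. Qed.

Lemma pm_eqb_trans M N : transitive (@pm_eqb hC M N).
Proof.
by move=> g f h /asboolP E /asboolP E'; apply/asboolP/(pm_equiv_trans hC E).
Qed.

Canonical pm_eqb_equiv M N := EquivRel (@pm_eqb hC M N)
  (@pm_eqb_refl M N) (@pm_eqb_sym M N) (@pm_eqb_trans M N).

Definition qhom M N : Type := {eq_quot (@pm_eqb hC M N)}.

(** [Tf] for an element [f : M' -> N/N'] of the direct system. *)
Definition qclass M N (f : premor C M N) : qhom M N :=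
  \pi_({eq_quot (@pm_eqb hC M N)}) f.

Definition qrepr M N (f : qhom M N) : premor C M N := repr f.

Lemma qreprK M N (f : qhom M N) : qclass (qrepr f) = f.
Proof. exact: reprK. Qed.

Lemma qclassP M N (f g : premor C M N) : qclass f = qclass g <-> pm_equiv f g.
Proof.
split=> [/eqmodP /asboolP //|E]; by apply/eqmodP/asboolP.
Qed.

Lemma qclass_surj M N (f : qhom M N) : exists f0, f = qclass f0.
Proof. by exists (qrepr f); rewrite qreprK. Qed.

Definition qid M : qhom M M := qclass (pm_of hC (idm M)).

Definition qcomp M N P (g : qhom N P) (f : qhom M N) : qhom M P :=
  qclass (sval (cid (pm_composite_ex hC (qrepr f) (qrepr g)))).

Lemma qcompG M N P (f : premor C M N) (g : premor C N P) h :
  graph_composite f g h -> qcomp (qclass g) (qclass f) = qclass h.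
Proof.
rewrite /qcomp; case: cid => h' /= /(pm_composite_graph hC) G' G.
apply/qclassP; apply: (graph_composite_equiv hC _ _ G' G);
  by apply/qclassP; rewrite qreprK.
Qed.

(** The composition does not depend on the choice of representatives. *)
Lemma qcompE M N P (f : premor C M N) (g : premor C N P) h :
  pm_composite f g h -> qcomp (qclass g) (qclass f) = qclass h.
Proof. by move=> /(pm_composite_graph hC); apply: qcompG. Qed.

Lemma qcompA X Y Z W (h : qhom Z W) (g : qhom Y Z) (f : qhom X Y) :
  qcomp h (qcomp g f) = qcomp (qcomp h g) f.
Proof.
have [f0 ->] := qclass_surj f; have [g0 ->] := qclass_surj g.
have [h0 ->] := qclass_surj h.
have [gf E1] := pm_composite_ex hC f0 g0; have [hg E2] := pm_composite_ex hC g0 h0.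
have [k E3] := pm_composite_ex hC gf h0; have [k' E4] := pm_composite_ex hC f0 hg.
rewrite (qcompE E1) (qcompE E2) (qcompE E3) (qcompE E4).
have G := pm_composite_graph hC.
exact/qclassP/(graph_compositeA hC (G _ _ _ _ _ _ E1)
  (G _ _ _ _ _ _ E2) (G _ _ _ _ _ _ E3) (G _ _ _ _ _ _ E4)).
Qed.

Lemma qcomp1m X Y (f : qhom X Y) : qcomp (qid Y) f = f.
Proof.
have [f0 ->] := qclass_surj f; apply: qcompG.
have [V [s [y [ss gy]]]] := graph_total hC f0 (idm X); rewrite comp1m in gy.
by exists V, s, y, y; split=> //; apply/graph_of; rewrite comp1m.
Qed.

Lemma qcompm1 X Y (f : qhom X Y) : qcomp f (qid X) = f.
Proof.
have [f0 ->] := qclass_surj f; apply: qcompG.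
have [V [s [y [ss gy]]]] := graph_total hC f0 (idm X); rewrite comp1m in gy.
by exists V, s, s, y; split=> //; apply/graph_of; rewrite comp1m.
Qed.

Definition quotient_category : category :=
  Category (@qcompA) (@qcomp1m) (@qcompm1).

Lemma qclass_of_id M : qclass (pm_of hC (idm M)) = qid M.
Proof. by []. Qed.

Lemma qclass_of_comp X Y Z (g : hom Y Z) (f : hom X Y) :
  qclass (pm_of hC (g ∘ f)) = qcomp (qclass (pm_of hC g)) (qclass (pm_of hC f)).
Proof.
apply/esym/qcompG; exists X, (idm X), f, (g ∘ f).
by split; [apply: (isoC_id hC)| | |]; rewrite ?graph_of ?compm1.
Qed.

Definition quotient_functor : functor A quotient_category :=
  @Functor A quotient_category (fun M => M)
    (fun M N f => qclass (pm_of hC f)) qclass_of_id qclass_of_comp.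

End QuotientCategory.

Section TensorFacts.
Variables (A : abelian) (M : monoidal A) (hM : biexact M).
Variables (C : A -> Prop) (hC : serre_tensor_ideal M C).
Implicit Types X Y Z W N P Q : A.

Lemma exact_mono (F : functor A A) X Y (f : hom X Y) :
  exact_functor F -> is_mono f -> is_mono (fmap F f).
Proof.
move=> hF mf; have [Q [c cc]] := ab_cokernel f.
by have [/kernel_mono] := hF _ _ _ _ _ (conj (mono_kernel mf cc) cc).
Qed.

Lemma exact_epi (F : functor A A) X Y (f : hom X Y) :
  exact_functor F -> is_epi f -> is_epi (fmap F f).
Proof.
move=> hF mf; have [Q [c cc]] := ab_kernel f.
by have [_ /cokernel_epi] := hF _ _ _ _ _ (conj cc (epi_cokernel mf cc)).
Qed.

Lemma exact_isoC (F : functor A A) X Y (f : hom X Y) :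
  exact_functor F -> (forall Z, C Z -> C (F Z)) ->
  isoC C f -> isoC C (fmap F f).
Proof.
move=> hF FC /isoC_image [I [e [m [[ee [K [k [kk CK]]]] [mm [Q [c [cc CQ]]]] ->]]]].
have [h1 _] := hF _ _ _ _ _ (conj kk (epi_cokernel ee kk)).
have [_ h2] := hF _ _ _ _ _ (conj (mono_kernel mm cc) cc).
rewrite fmapM; split.
  exists (F K), (fmap F k); split; last exact: FC.
  by apply/(kernel_monol _ _ (exact_mono hF mm)).
exists (F Q), (fmap F c); split; last exact: FC.
by apply/(cokernel_epir _ _ (exact_epi hF ee)).
Qed.

Lemma tensmE X X' Y Y' (f : hom X X') (g : hom Y Y') :
  tensm M f g = fmap (tensR M Y') f ∘ fmap (tensL M X) g.
Proof. by rewrite /= -tensmM comp1m compm1. Qed.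

Lemma tensm_mono X X' Y Y' (f : hom X X') (g : hom Y Y') :
  is_mono f -> is_mono g -> is_mono (tensm M f g).
Proof.
move=> mf mg; rewrite tensmE; apply: mono_comp.
  by apply: (exact_mono (proj1 (hM Y'))).
by apply: (exact_mono (proj2 (hM X))).
Qed.

Lemma tensm_epi X X' Y Y' (f : hom X X') (g : hom Y Y') :
  is_epi f -> is_epi g -> is_epi (tensm M f g).
Proof.
move=> mf mg; rewrite tensmE; apply: epi_comp.
  by apply: (exact_epi (proj1 (hM Y'))).
by apply: (exact_epi (proj2 (hM X))).
Qed.

Lemma tensm_isoC X X' Y Y' (f : hom X X') (g : hom Y Y') :
  isoC C f -> isoC C g -> isoC C (tensm M f g).
Proof.
move=> sf sg; rewrite tensmE; apply: (isoC_comp hC).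
  by apply: (exact_isoC (proj1 (hM Y'))) => // Z; apply: (ideal_tensR hC).
by apply: (exact_isoC (proj2 (hM X))) => // Z; apply: (ideal_tensL hC).
Qed.

Lemma tensm_incl_in X X' Y Y' (f : hom X X') (g : hom Y Y') :
  is_mono f -> is_mono g -> cokernel_in C f -> cokernel_in C g ->
  cokernel_in C (tensm M f g).
Proof.
by move=> mf mg cf cg; apply: (proj2 (tensm_isoC _ _)); apply: (isoC_mono hC).
Qed.

Lemma tensm_proj_in X X' Y Y' (f : hom X X') (g : hom Y Y') :
  is_epi f -> is_epi g -> kernel_in C f -> kernel_in C g ->
  kernel_in C (tensm M f g).
Proof.
by move=> mf mg cf cg; apply: (proj1 (tensm_isoC _ _)); apply: (isoC_epi hC).
Qed.

(** [f ⊗ g : M' ⊗ X' -> (N/N') ⊗ (Y/Y')] for [f : M' -> N/N'] and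
    [g : X' -> Y/Y']. *)
Definition pm_tens X X' Y Y' (f : premor C X X') (g : premor C Y Y') :
    premor C (tens M X Y) (tens M X' Y') :=
  Premor
    (tensm_mono (@pm_incl_mono _ _ _ _ f) (@pm_incl_mono _ _ _ _ g))
    (tensm_incl_in (@pm_incl_mono _ _ _ _ f) (@pm_incl_mono _ _ _ _ g)
       (pm_incl_in f) (pm_incl_in g))
    (tensm_epi (@pm_proj_epi _ _ _ _ f) (@pm_proj_epi _ _ _ _ g))
    (tensm_proj_in (@pm_proj_epi _ _ _ _ f) (@pm_proj_epi _ _ _ _ g)
       (pm_proj_in f) (pm_proj_in g))
    (tensm M (pm_map f) (pm_map g)).

Definition qtens X X' Y Y' (f : qhom hC X X') (g : qhom hC Y Y') :
    qhom hC (tens M X Y) (tens M X' Y') :=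
  qclass hC (pm_tens (qrepr f) (qrepr g)).

Lemma graph_tens X X' Y Y' (f : premor C X X') (g : premor C Y Y') W V
    (x : hom W X) y (x' : hom V Y) y' :
  graph f x y -> graph g x' y' ->
  graph (pm_tens f g) (tensm M x x') (tensm M y y').
Proof.
move=> [a [<- E]] [a' [<- E']]; exists (tensm M a a') => /=.
by rewrite -!tensmM E E'.
Qed.

(** The tensor product does not depend on the choice of representatives. *)
Lemma qtensE X X' Y Y' (f : premor C X X') (g : premor C Y Y') :
  qtens (qclass hC f) (qclass hC g) = qclass hC (pm_tens f g).
Proof.
apply/qclassP.
have /(equiv_graph hC) [W [s [y [ss g1 g2]]]] : pm_equiv (qrepr (qclass hC f)) f.
  by apply/(@qclassP _ _ hC); rewrite qreprK.
have /(equiv_graph hC) [W' [s' [y' [ss' g1' g2']]]] :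
    pm_equiv (qrepr (qclass hC g)) g.
  by apply/(@qclassP _ _ hC); rewrite qreprK.
apply: (graph_equiv hC (tensm_isoC ss ss') (graph_tens g1 g1')).
exact: graph_tens.
Qed.

Lemma graph_composite_tens X X' X'' Y Y' Y'' (f : premor C X X')
    (g : premor C X' X'') h (f' : premor C Y Y') (g' : premor C Y' Y'') h' :
  graph_composite f g h -> graph_composite f' g' h' ->
  graph_composite (pm_tens f f') (pm_tens g g') (pm_tens h h').
Proof.
move=> [W [s [y [z [ss gf gg gh]]]]] [W' [s' [y' [z' [ss' gf' gg' gh']]]]].
exists (tens M W W'), (tensm M s s'), (tensm M y y'), (tensm M z z').
by split; [apply: tensm_isoC | apply: graph_tens..].
Qed.

Local Notation Cat := (quotient_category hC).
Local Notation T := (quotient_functor hC).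

Lemma qtensmM X X' X'' Y Y' Y'' (g : @hom Cat X' X'') (f : @hom Cat X X')
    (g' : @hom Cat Y' Y'') (f' : @hom Cat Y Y') :
  qtens (g ∘ f) (g' ∘ f') =
  (qtens g g' : @hom Cat (tens M X' Y') (tens M X'' Y''))
    ∘ (qtens f f' : @hom Cat (tens M X Y) (tens M X' Y')).
Proof.
have [f0 ->] := qclass_surj f; have [g0 ->] := qclass_surj g.
have [f0' ->] := qclass_surj f'; have [g0' ->] := qclass_surj g'.
have [h E] := pm_composite_ex hC f0 g0; have [h' E'] := pm_composite_ex hC f0' g0'.
rewrite /comp /= (qcompE hC E) (qcompE hC E') !qtensE.
apply/esym/qcompG/graph_composite_tens; exact: (pm_composite_graph hC).
Qed.

Lemma qtens_fmap X X' Y Y' (f : hom X X') (g : hom Y Y') :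
  qtens (fmap T f) (fmap T g) = fmap T (tensm M f g).
Proof.
rewrite /= qtensE; apply/qclassP.
apply: (@graph_equiv _ _ hC _ _ _ _ _ (idm _) (tensm M f g)).
- exact: (isoC_id hC).
- by rewrite -tensm1; apply: graph_tens; apply/graph_of; rewrite compm1.
- by apply/graph_of; rewrite compm1.
Qed.

Lemma qtensm1 X Y : qtens (idm (X : Cat)) (idm (Y : Cat)) = idm (tens M X Y : Cat).
Proof. by have := qtens_fmap (idm X) (idm Y); rewrite tensm1. Qed.

Lemma fmap_iso (B D : category) (F : functor B D) (X Y : B)
    (f : hom X Y) :
  is_iso f -> is_iso (fmap F f).
Proof.
by move=> [g [E1 E2]]; exists (fmap F g); rewrite -!fmapM E1 E2 !fmap1.
Qed.

(* A morphism of A/C is, up to the images under T of morphisms in [isoC], the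
   image under T of a morphism of A. *)
Lemma qclass_roof X Y (f : @hom Cat X Y) :
  exists W (s : hom W X) (y : hom W Y), isoC C s /\ f ∘ fmap T s = fmap T y.
Proof.
have [f0 ->] := qclass_surj f.
have [W [s [y [ss gy]]]] := graph_total hC f0 (idm X); rewrite comp1m in gy.
exists W, s, y; split=> //; apply: qcompG.
exists W, (idm W), s, y; split=> //; first exact: (isoC_id hC).
  by apply/graph_of; rewrite compm1.
by apply/graph_of; rewrite compm1.
Qed.

Lemma fmap_isoC_epi X Y (s : hom X Y) : isoC C s -> is_epi (fmap T s).
Proof.
move=> ss P u v.
have [u0 ->] := qclass_surj u; have [v0 ->] := qclass_surj v.
have [h E] := pm_composite_ex hC (pm_of hC s) u0.
have [h' E'] := pm_composite_ex hC (pm_of hC s) v0.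
rewrite /comp /= (qcompE hC E) (qcompE hC E') => /qclassP eh; apply/qclassP.
have [W [s1 [y1 [z1 [ss1 /graph_of -> g1 gh]]]]] := pm_composite_graph hC E.
have [V [t [st gt]]] := graph_equiv_transfer hC eh gh.
have [W2 [s2 [y2 [z2 [ss2 g2 g2' gh2]]]]] := pm_composite_graph hC E'.
have [V' [t' [w [st' Es Ez]]]] := graph_dom hC ss2 gh2 gt.
move: g2 g2' => /graph_of -> g2'.
apply: (@graph_equiv _ _ hC _ _ _ _ _ (s ∘ (s1 ∘ t ∘ t')) (z1 ∘ t ∘ t')).
- by do 3 apply: (isoC_comp hC) => //.
- by rewrite !compA; do 2 apply: graph_comp.
- by rewrite Es Ez compA; apply: graph_comp.
Qed.

Lemma qassoc_nat X X' Y Y' Z Z' (f : @hom Cat X X') (g : @hom Cat Y Y')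
    (h : @hom Cat Z Z') :
  fmap T (tassoc M X' Y' Z') ∘ qtens (qtens f g) h =
  (qtens f (qtens g h) : @hom Cat (tens M X (tens M Y Z)) (tens M X' (tens M Y' Z')))
    ∘ fmap T (tassoc M X Y Z).
Proof.
have [U [s [x [ss Ex]]]] := qclass_roof f; have [V [t [y [st Ey]]]] := qclass_roof g.
have [W [r [z [sr Ez]]]] := qclass_roof h.
apply: (fmap_isoC_epi (tensm_isoC (tensm_isoC ss st) sr)).
rewrite -!compA -fmapM tassoc_nat fmapM -!qtens_fmap [RHS]compA.
rewrite -!qtensmM Ex Ey Ez !qtens_fmap -!fmapM.
by rewrite tassoc_nat.
Qed.

Lemma qlunit_nat X X' (f : @hom Cat X X') :
  fmap T (tlunit M X') ∘ qtens (idm (tunit M : Cat)) f = f ∘ fmap T (tlunit M X).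
Proof.
have [U [s [x [ss Ex]]]] := qclass_roof f.
apply: (fmap_isoC_epi (tensm_isoC (isoC_id hC (tunit M)) ss)).
rewrite -!compA -fmapM tlunit_nat fmapM -qtens_fmap fmap1 [RHS]compA Ex.
by rewrite -qtensmM Ex comp1m -(fmap1 T) qtens_fmap -!fmapM tlunit_nat.
Qed.

Lemma qrunit_nat X X' (f : @hom Cat X X') :
  fmap T (trunit M X') ∘ qtens f (idm (tunit M : Cat)) = f ∘ fmap T (trunit M X).
Proof.
have [U [s [x [ss Ex]]]] := qclass_roof f.
apply: (fmap_isoC_epi (tensm_isoC ss (isoC_id hC (tunit M)))).
rewrite -!compA -fmapM trunit_nat fmapM -qtens_fmap fmap1 [RHS]compA Ex.
by rewrite -qtensmM Ex comp1m -(fmap1 T) qtens_fmap -!fmapM trunit_nat.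
Qed.

Lemma qpentagon W X Y Z :
  fmap T (tassoc M W X (tens M Y Z)) ∘ fmap T (tassoc M (tens M W X) Y Z) =
  (qtens (idm (W : Cat)) (fmap T (tassoc M X Y Z))
     : @hom Cat (tens M W (tens M (tens M X Y) Z)) (tens M W (tens M X (tens M Y Z))))
    ∘ fmap T (tassoc M W (tens M X Y) Z)
    ∘ qtens (fmap T (tassoc M W X Y)) (idm (Z : Cat)).
Proof.
rewrite -!(fmap1 T) !qtens_fmap -!fmapM tpentagon.
exact: fmapM.
Qed.

Lemma qtriangle X Y :
  (qtens (idm (X : Cat)) (fmap T (tlunit M Y))
     : @hom Cat (tens M X (tens M (tunit M) Y)) (tens M X Y))
    ∘ fmap T (tassoc M X (tunit M) Y) =
  qtens (fmap T (trunit M X)) (idm (Y : Cat)).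
Proof. by rewrite -!(fmap1 T) !qtens_fmap -!fmapM ttriangle. Qed.

Definition quotient_monoidal : monoidal Cat :=
  @Monoidal Cat (tens M) qtens qtensm1 qtensmM (tunit M)
    (fun X Y Z => fmap T (tassoc M X Y Z))
    (fun X => fmap T (tlunit M X))
    (fun X => fmap T (trunit M X))
    (fun X Y Z => fmap_iso T (tassoc_iso M X Y Z))
    (fun X => fmap_iso T (tlunit_iso M X))
    (fun X => fmap_iso T (trunit_iso M X))
    qassoc_nat qlunit_nat qrunit_nat qpentagon qtriangle.

End TensorFacts.

(* Main.v *)
From mathcomp Require Import ssreflect ssrfun.
Require Import Defs.

(** The tensor product of A/C agrees on objects, on the unit and, through [T],
    on morphisms of A with the one of A, and its constraints are images under
    [T].  So [T] is strictly monoidal: the structure maps are identities, the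
    naturality square is the formula [qtens_fmap], that [T f ⊗ T g] equals
    [T (f ⊗ g)], and each coherence axiom reduces to an identity law once
    tensor products of identities are contracted by [qtensm1]. *)

Theorem mainTheorem3 (A : abelian) (M : monoidal A) (hM : biexact M)
    (C : A -> Prop) (hC : serre_tensor_ideal M C) :
  is_monoidal_functor M (quotient_monoidal hM hC) (quotient_functor hC).
Proof.
set Cat := quotient_category hC.
exists (fun X Y => @idm Cat (tens M X Y)), (@idm Cat (tunit M)).
have iso1 (X : Cat) : is_iso (idm X) by exists (idm X); rewrite comp1m.
have tens1 (X Y : Cat) : qtens hM (idm X) (idm Y) = @idm Cat (tens M X Y).
  exact: qtensm1.
split=> //.
- move=> X X' Y Y' f g; rewrite compm1 comp1m.
  exact/esym/qtens_fmap.
- move=> X Y Z; rewrite [u in comp u _ = _]compm1 [u in _ = comp u _]comp1m.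
  rewrite [u in comp _ u = _]tens1 [u in _ = comp u _]tens1.
  by rewrite [LHS]compm1 [RHS]comp1m.
- move=> X; rewrite [u in comp u _ = _]compm1 [u in comp _ u = _]tens1.
  exact: compm1.
- move=> X; rewrite [u in comp u _ = _]compm1 [u in comp _ u = _]tens1.
  exact: compm1.
Qed.
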